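(* Let $\mathcal{H}$ be a real Hilbert space, $A:\mathcal{H}\rightrightarrows\mathcal{H}$ a set-valued operator, $\gamma>0$, and $F:\mathcal{H}\to\mathcal{H}$ single-valued. Assume that the resolvents $T_{\gamma A}^F=F\circ(\gamma A+F)^{-1}$ (transformed) and $J_{\gamma A}^F=(\gamma A+F)^{-1}\circ F$ (warped) are everywhere defined on $\mathcal{H}$. If $(A,F)\in\mathcal{M}_\alpha$ with $\alpha\geq0$, then $$\mathcal{G}(F\circ J_{\gamma A}^F,F)\subseteq D\!\left(\tfrac{1}{2+2\gamma\alpha},\tfrac{1}{2+2\gamma\alpha}\right).$$ If, moreover, $F^{-1}$ is well-defined (as a single-valued map $\mathcal{H}\to\mathcal{H}$) and $l$-Lipschitz, and $F$ is $L$-Lipschitz, then $$\mathcal{G}(J_{\gamma A}^F,\mathrm{id})\subseteq D\!\left(0,\tfrac{Ll}{1+\gamma\alpha}\right).$$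
   Context: Operators: for $A:\mathcal{H}\rightrightarrows\mathcal{H}$, $\operatorname{gph}A=\{(x,u):u\in A(x)\}$, $\operatorname{dom}A=\{x:A(x)\neq\emptyset\}$, $A^{-1}(u)=\{x:u\in A(x)\}$, $(A\circ B)(x)=\bigcup_{y\in B(x)}A(y)$; sums and scalar multiples are pointwise (Minkowski). A single-valued $F:\mathcal{H}\to\mathcal{H}$ is identified with $x\mapsto\{F(x)\}$. An operator $A$ is $L$-Lipschitz ($L>0$) if $\|u-\bar u\|\leq L\|x-\bar x\|$ for all $(x,u),(\bar x,\bar u)\in\operatorname{gph}A$. The warped resolvent $J_{\gamma A}^F$ is defined provided that $\operatorname{ran}F\subseteq\operatorname{ran}(\gamma A+F)$. $\mathcal{M}_\alpha$ is the class of $\alpha$-monotone operator pairs: $(A,B)\in\mathcal{M}_\alpha$ iff $\langle u_A-\bar u_A,u_B-\bar u_B\rangle\geq\alpha\|u_B-\bar u_B\|^2$ for all $(x,u_A),(\bar x,\bar u_A)\in\operatorname{gph}A$ and $(x,u_B),(\bar x,\bar u_B)\in\operatorname{gph}B$. $D(c,r)=\{z\in\mathbb{C}:|z-c|\leq r\}$; $\overline{\mathbb{C}}=\mathbb{C}\cup\{\infty\}$. Scaled relative graph of a pair: for $a,b\in\mathcal{H}$ with $b\neq0$ let $z_\pm(a,b)=\frac{\|a\|}{\|b\|}\exp(\pm i\angle(b,a))$ (a complex-conjugate pair), where $\angle(b,a)=\arccos\frac{\langle b,a\rangle}{\|b\|\|a\|}\in[0,\pi]$ if $a\neq0$ and $b\neq0$,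 and $\angle(b,a)=0$ otherwise. For $A,B:\mathcal{H}\rightrightarrows\mathcal{H}$, $\mathcal{G}(A,B)\subseteq\overline{\mathbb{C}}$ consists of all points $z_\pm(u_A-\bar u_A,u_B-\bar u_B)$ (both signs) with $x,\bar x\in\operatorname{dom}A\cap\operatorname{dom}B$, $u_A\in A(x)$, $\bar u_A\in A(\bar x)$, $u_B\in B(x)$, $\bar u_B\in B(\bar x)$ and $u_B\neq\bar u_B$; additionally $\infty\in\mathcal{G}(A,B)$ if and only if there exist $(x,u_A),(\bar x,\bar u_A)\in\operatorname{gph}A$ and $(x,u_B),(\bar x,\bar u_B)\in\operatorname{gph}B$ (possibly $x=\bar x$) with $u_B=\bar u_B$ and $u_A\neq\bar u_A$. *)

(* Defs.v *)
From HB Require Import structures.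
From mathcomp Require Import all_boot all_order all_algebra.
From mathcomp Require Import all_classical all_reals all_analysis.
From mathcomp Require Import complex.

Set Implicit Arguments.
Unset Strict Implicit.
Unset Printing Implicit Defensive.

Import Order.TTheory GRing.Theory Num.Theory.
Import numFieldNormedType.Exports.

Local Open Scope classical_set_scope.
Local Open Scope ring_scope.
Local Open Scope complex_scope.

Definition operator (H : Type) := H -> set H.

Section Operators.
Variables (R : realType) (H : normedModType R).
Implicit Types (A B : operator H) (F : H -> H).

Definition op_fun F : operator H := fun x => [set F x].

Definition gph A : set (H * H) := [set p | A p.1 p.2].

Definition op_dom A : set H := [set x | A x !=set0].

Definition op_inv A : operator H := fun u => [set x | A x u].

Definition op_comp A B : operator H := fun x => \bigcup_(y in B x) A y.

Definition op_add A B : operator H :=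
  fun x => [set u + v | u in A x & v in B x].

Definition op_scale (c : R) A : operator H := fun x => [set c *: u | u in A x].

Definition op_lipschitz (L : R) A : Prop :=
  0 < L /\
  forall x x' u u' : H,
    gph A (x, u) -> gph A (x', u') -> `|u - u'| <= L * `|x - x'|.

Definition transformed_resolvent (gamma : R) A F : operator H :=
  op_comp (op_fun F) (op_inv (op_add (op_scale gamma A) (op_fun F))).

Definition warped_resolvent (gamma : R) A F : operator H :=
  op_comp (op_inv (op_add (op_scale gamma A) (op_fun F))) (op_fun F).

End Operators.

(* The inner product is a parameter because the libraries have no Hilbert space
   structure; theorems take H complete and tie the norm to [dot] by a
   hypothesis. *)
Section ScaledRelativeGraph.
Variables (R : realType) (H : normedModType R) (dot : {dot H for idfun}).
Implicit Types (A B : operator H).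

Definition alpha_monotone (alpha : R) A B : Prop :=
  forall x x' uA uA' uB uB' : H,
    gph A (x, uA) -> gph A (x', uA') ->
    gph B (x, uB) -> gph B (x', uB') ->
    alpha * `|uB - uB'| ^+ 2 <= dot (uA - uA') (uB - uB').

Definition angle (b a : H) : R :=
  if (a != 0) && (b != 0) then acos (dot b a / (`|b| * `|a|)) else 0.

(* exp(i t): the libraries have no complex exponential. *)
Definition expi (t : R) : R[i] := cos t +i* sin t.

(* [neg] selects the sign: false for z_+, true for z_-. *)
Definition srg_point (neg : bool) (a b : H) : R[i] :=
  (`|a| / `|b|)%:C * expi ((-1) ^+ neg * angle b a).

Definition srg_finite A B : set R[i] :=
  [set z | exists x x' uA uA' uB uB' : H,
    [/\ (op_dom A `&` op_dom B) x, (op_dom A `&` op_dom B) x',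
        A x uA /\ A x' uA', B x uB /\ B x' uB' &
        uB <> uB' /\
        exists neg : bool, z = srg_point neg (uA - uA') (uB - uB')]].

Definition srg_has_infty A B : Prop :=
  exists x x' uA uA' uB uB' : H,
    [/\ gph A (x, uA) /\ gph A (x', uA'), gph B (x, uB) /\ gph B (x', uB'),
        uB = uB' & uA <> uA'].

End ScaledRelativeGraph.

(* The extended complex plane: [None] is the point at infinity. *)
Definition extended_complex (R : realType) := option R[i].

Definition srg (R : realType) (H : normedModType R) (dot : {dot H for idfun})
    (A B : operator H) : set (extended_complex R) :=
  [set w | match w with
           | Some z => srg_finite dot A B z
           | None => srg_has_infty A B
           end].

Definition disk (R : realType) (c : R[i]) (r : R) : set R[i] :=
  [set z | `|z - c| <= r%:C].

Definition finite_part (R : realType) (D : set R[i]) :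
  set (extended_complex R) := [set Some z | z in D].

(* Main.v *)
(** If [y] and [y'] lie in the warped resolvent at [x] and [x'], then
    [F x - F y] and [F x' - F y'] lie in [gamma A y] and [gamma A y'].  With
    [p = F x - F x'] and [q = F y - F y'], monotonicity of the pair [(A, F)]
    reads [(1 + gamma alpha) |q|^2 <= <q, p>].  A point [z] of the scaled
    relative graph at [(q, p)] has [|z| = |q| / |p|] and
    [Re z = <q, p> / |p|^2], and [z] is in [D(r, r)] iff [|z|^2 <= 2 r Re z],
    so this inequality is exactly the first inclusion.  By Cauchy-Schwarz it
    also gives [(1 + gamma alpha) |q| <= |p|], and the Lipschitz bounds of [F]
    and its inverse turn this into the second inclusion. *)
Require Import Defs.
From HB Require Import structures.
From mathcomp Require Import all_boot all_order all_algebra.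
From mathcomp Require Import all_classical all_reals all_analysis.
From mathcomp Require Import complex.
From mathcomp Require Import ring lra.

Set Implicit Arguments.
Unset Strict Implicit.
Unset Printing Implicit Defensive.

Import Order.TTheory GRing.Theory Num.Theory.
Import numFieldNormedType.Exports.

Local Open Scope classical_set_scope.
Local Open Scope ring_scope.
Local Open Scope complex_scope.

Section InnerProduct.
Variables (R : realType) (H : normedModType R) (dot : {dot H for idfun}).
Hypothesis dot_norm : forall x : H, dot x x = `|x| ^+ 2.

Lemma dot_sym (x y : H) : dot x y = dot y x.
Proof. by rewrite hermC expr0 mul1r. Qed.

(* Expanding the square of [|x + y| <= |x| + |y|] leaves Cauchy-Schwarz. *)
Lemma dot_le_norm (x y : H) : dot x y <= `|x| * `|y|.
Proof.
have le2 : `|x + y| ^+ 2 <= (`|x| + `|y|) ^+ 2.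
  by rewrite ler_pXn2r ?nnegrE ?addr_ge0// ler_normD.
move: le2; rewrite -dot_norm linearDl !linearD/= !dot_norm (dot_sym y x).
by nra.
Qed.

Lemma norm_dot_le (x y : H) : `|dot x y| <= `|x| * `|y|.
Proof.
by rewrite ler_norml dot_le_norm lerNl -linearN/= -[`|y|]normrN dot_le_norm.
Qed.

Lemma cos_angle (a b : H) : a != 0 -> b != 0 ->
  cos (angle dot b a) = dot a b / (`|a| * `|b|).
Proof.
move=> a0 b0; have ab0 : 0 < `|b| * `|a| by rewrite mulr_gt0 ?normr_gt0.
rewrite /angle a0 b0/= acosK.
  by rewrite dot_sym (mulrC `|a|).
(* Cauchy-Schwarz puts the quotient in [-1, 1], where [cos] undoes [acos]. *)
rewrite in_itv/= -ler_norml normrM normfV (gtr0_norm ab0).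
by rewrite ler_pdivrMr// mul1r norm_dot_le.
Qed.

Lemma normc_srg_point (neg : bool) (a b : H) :
  `|srg_point dot neg a b| = (`|a| / `|b|)%:C.
Proof.
rewrite normrM !normc_def/= cos2Dsin2 sqrtr1 mulr1 expr0n/= addr0.
by rewrite sqrtr_sqr ger0_norm ?divr_ge0.
Qed.

(** Cosine is even, so both signs share one real part, and the norm of a cancels against the
    denominator of the cosine. For a = 0 the angle is 0 by convention and the modulus vanishes. *)
Lemma Re_srg_point (neg : bool) (a b : H) : b != 0 ->
  complex.Re (srg_point dot neg a b) = dot a b / `|b| ^+ 2.
Proof.
move=> b0; rewrite /= mul0r subr0.
have -> : cos ((-1) ^+ neg * angle dot b a) = cos (angle dot b a).
  by case: neg; rewrite ?expr1 ?expr0 ?mulN1r ?mul1r ?cosN.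
have [->|a0] := eqVneq a 0; first by rewrite linear0l normr0 !mul0r.
rewrite cos_angle//; move: a0 b0.
rewrite -(normr_eq0 a) -(normr_eq0 b) => a0 b0.
by field; apply/andP.
Qed.

End InnerProduct.

(** Squaring |z - r| <= r cancels r^2, since the boundary circle passes through 0. *)
Lemma in_disk_tangent (R : realType) (r : R) (z : R[i]) : 0 <= r ->
  `|z| ^+ 2 <= (2 * r * complex.Re z)%:C -> disk r%:C r z.
Proof.
case: z => x y r0; rewrite /disk/= !normc_def/= -rmorphXn/= !lecR subr0.
rewrite sqr_sqrtr ?addr_ge0 ?sqr_ge0// => le_xy.
rewrite -[leRHS](ger0_norm r0) -sqrtr_sqr ler_wsqrtr//; lra.
Qed.

Section WarpedResolvent.
Variables (R : realType) (H : normedModType R) (dot : {dot H for idfun}).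
Hypothesis dot_norm : forall x : H, dot x x = `|x| ^+ 2.
Variables (A : operator H) (F : H -> H) (gamma alpha : R).
Hypotheses (gamma_gt0 : 0 < gamma) (alpha_ge0 : 0 <= alpha).
Hypothesis AF_mono : alpha_monotone dot alpha A (op_fun F).

Lemma warped_resolventP (x y : H) :
  warped_resolvent gamma A F x y -> exists2 a, A y a & F x = gamma *: a + F y.
Proof. by move=> [_ -> [_ [a Aa <-] [_ -> <-]]]; exists a. Qed.

(** With q = F y - F y', the right side splits as gamma <q, a - a'> + |q|^2 for a in A y and a' in A
    y'; monotonicity bounds the first term. *)
Lemma warped_resolvent_cocoercive (x x' y y' : H) :
  warped_resolvent gamma A F x y -> warped_resolvent gamma A F x' y' ->
  (1 + gamma * alpha) * `|F y - F y'| ^+ 2 <= dot (F y - F y') (F x - F x').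
Proof.
move=> /warped_resolventP[a Aa ->] /warped_resolventP[a' Aa' ->].
have -> : gamma *: a + F y - (gamma *: a' + F y') =
          gamma *: (a - a') + (F y - F y').
  by rewrite scalerBr opprD addrACA.
rewrite linearD linearZ/= dot_norm mulrDl mul1r addrC lerD2r -mulrA.
rewrite ler_pM2l// dot_sym; exact: AF_mono Aa Aa' erefl erefl.
Qed.

Lemma warped_resolvent_contraction (x x' y y' : H) :
  warped_resolvent gamma A F x y -> warped_resolvent gamma A F x' y' ->
  (1 + gamma * alpha) * `|F y - F y'| <= `|F x - F x'|.
Proof.
move=> Jy Jy'; have le_dot := warped_resolvent_cocoercive Jy Jy'.
(* The bound comes from cancelling one factor |q| in the quadratic estimate, so q = 0 is set
   apart. *)
have [->|q0] := eqVneq (F y - F y') 0; first by rewrite normr0 mulr0.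
have q_gt0 : 0 < `|F y - F y'| by rewrite normr_gt0.
rewrite -(ler_pM2l q_gt0) mulrCA -expr2.
exact: le_trans le_dot (dot_le_norm dot_norm _ _).
Qed.

Lemma srg_transformed_warped_resolvent :
  srg dot (op_comp (op_fun F) (warped_resolvent gamma A F)) (op_fun F)
    `<=` finite_part (disk (1 / (2 + 2 * gamma * alpha))%:C
                           (1 / (2 + 2 * gamma * alpha))).
Proof.
have c0 : 0 < 1 + gamma * alpha.
  by rewrite ltr_pwDl// mulr_ge0// ltW.
have -> : 2 + 2 * gamma * alpha = 2 * (1 + gamma * alpha) by ring.
case=> [z|].
  move=> [x [x' [uA [uA' [uB [uB' [_ _ [Au Au'] [Bu Bu'] [neqB]]]]]]]] [neg ->].
  case: Au => y Jy ->; case: Au' => y' Jy' ->.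
  rewrite Bu Bu' in neqB *.
  have p0 : F x - F x' != 0 by rewrite subr_eq0; apply/eqP.
  have np : 0 < `|F x - F x'| by rewrite normr_gt0.
  eexists; last by [].
  apply: in_disk_tangent; first by rewrite divr_ge0// mulr_ge0// ltW.
  rewrite normc_srg_point Re_srg_point// -rmorphXn/= lecR expr_div_n.
  (* Both sides carry the factor 1 / |F x - F x'|^2. *)
  rewrite mulrA ler_pM2r ?invr_gt0 ?exprn_gt0//.
  have -> : 2 * (1 / (2 * (1 + gamma * alpha))) = (1 + gamma * alpha)^-1.
    by field; rewrite gt_eqF.
  rewrite mulrC ler_pdivlMr// mulrC.
  exact: warped_resolvent_cocoercive Jy Jy'.
(* The point at infinity would need F x = F x' with F y <> F y', which the contraction bound
   excludes. *)
move=> [x [x' [uA [uA' [uB [uB' [[Au Au'] [Bu Bu'] eqB]]]]]]] [].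
case: Au => y Jy /= ->; case: Au' => y' Jy' /= ->.
have eqF : F x = F x' := etrans (esym Bu) (etrans eqB Bu').
have := warped_resolvent_contraction Jy Jy'.
rewrite eqF subrr normr0 pmulr_rle0// normr_le0 subr_eq0.
by move/eqP.
Qed.

(** Three bounds are chained: l from y to F y, 1 / (1 + gamma alpha) from F y to F x, and L from F x
    to x. *)
Lemma warped_resolvent_lipschitz (l L : R) :
  op_lipschitz l (op_inv (op_fun F)) -> op_lipschitz L (op_fun F) ->
  forall x x' y y' : H,
  warped_resolvent gamma A F x y -> warped_resolvent gamma A F x' y' ->
  `|y - y'| <= L * l / (1 + gamma * alpha) * `|x - x'|.
Proof.
move=> [l0 lip_inv] [L0 lip] x x' y y' Jy Jy'.
have c0 : 0 < 1 + gamma * alpha.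
  by rewrite ltr_pwDl// mulr_ge0// ltW.
apply: le_trans (lip_inv (F y) (F y') y y' erefl erefl) _.
rewrite (mulrC L) -!mulrA ler_pM2l// mulrCA ler_pdivlMl//.
apply: le_trans (warped_resolvent_contraction Jy Jy') _.
exact: lip.
Qed.

End WarpedResolvent.

(** Against the identity, the modulus of a point is the difference quotient |y - y'| / |x - x'|. At
    x = x' the bound makes T single-valued, which rules out infinity. *)
Lemma srg_lipschitz (R : realType) (H : normedModType R)
    (dot : {dot H for idfun}) (T : operator H) (c : R) :
  (forall x x' y y', T x y -> T x' y' -> `|y - y'| <= c * `|x - x'|) ->
  srg dot T (op_fun idfun) `<=` finite_part (disk 0 c).
Proof.
move=> lipT [z [x [x' [y [y' [u [u' [_ _ [Ty Ty'] [-> ->] [neq [neg ->]]]]]]]]]|].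
  eexists; last by [].
  rewrite /disk/= subr0 normc_srg_point lecR ler_pdivrMr; first exact: lipT.
  by rewrite normr_gt0 subr_eq0; apply/eqP.
move=> [x [x' [y [y' [u [u' [[Ty Ty'] [ux ux'] equ]]]]]]] [].
have eqx : x = x' := etrans (esym ux) (etrans equ ux').
have := lipT _ _ _ _ Ty Ty'.
by rewrite /= eqx subrr normr0 mulr0 normr_le0 subr_eq0 => /eqP.
Qed.

Theorem mainTheorem6 (R : realType) (H : completeNormedModType R)
    (dot : {dot H for idfun})
    (dot_norm : forall x : H, dot x x = `|x| ^+ 2)
    (A : operator H) (gamma : R) (gamma_gt0 : 0 < gamma) (F : H -> H)
    (dom_T : op_dom (transformed_resolvent gamma A F) = [set: H])
    (dom_J : op_dom (warped_resolvent gamma A F) = [set: H])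
    (alpha : R) (alpha_ge0 : 0 <= alpha)
    (AF_mono : alpha_monotone dot alpha A (op_fun F)) :
  srg dot (op_comp (op_fun F) (warped_resolvent gamma A F)) (op_fun F)
    `<=` finite_part (disk (1 / (2 + 2 * gamma * alpha))%:C
                           (1 / (2 + 2 * gamma * alpha)))
  /\
  (forall l L : R,
     (exists Finv : H -> H, op_inv (op_fun F) = op_fun Finv) ->
     op_lipschitz l (op_inv (op_fun F)) ->
     op_lipschitz L (op_fun F) ->
     srg dot (warped_resolvent gamma A F) (op_fun idfun)
       `<=` finite_part (disk 0 (L * l / (1 + gamma * alpha)))).
Proof.
split=> [|l L _ lip_inv lip]; first exact: srg_transformed_warped_resolvent.
exact/srg_lipschitz/warped_resolvent_lipschitz.
Qed.
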